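(* For all $0\le k\le n$, the generalised Koornwinder polynomials satisfy $$\frac{\partial}{\partial y}H_{n,k}^{(a,b,c,d)}(x,y)=d_{k-1}^{(d+1,c+1)}\,H_{n-1,k-1}^{(a,b,c+1,d+1)}(x,y)$$ (the right-hand side being zero for $k=0$), and thus the matrix $D_y^{(a,b,c,d)}$, defined by $\frac{\partial}{\partial y}\mathbf H^{(a,b,c,d)}=\mathbf H^{(a,b,c+1,d+1)}D_y^{(a,b,c,d)}$, has block-bandwidths $(-1,1)$ and each block has bandwidths $(-1,1)$.
   Context: Setting. Let $\alpha<\beta$ and $\gamma<\delta$ be real, and let $\rho$ be a function on $[\alpha,\beta]$, positive on $(\alpha,\beta)$, with either: case (i), $\rho$ is a polynomial of degree $d_0$; or case (ii), $\rho$ is the square root of a polynomial of degree $d_1=\deg\rho^2$ and $\delta=-\gamma>0$. Put $\eta=0$ in case (i), $\eta=1$ in case (ii), so $d_\eta=\deg\rho^{1+\eta}$; assume $d_\eta\ge 2+\eta$. Let $\Omega=\{(x,y):\alpha\le x\le\beta,\ \gamma\rho(x)\le y\le\delta\rho(x)\}$. The parameters $a,b,c,d>-1$ are real, with $c=d$ in case (ii), and such that the weights below are integrable. Polynomials. $w_R^{(a,b,s)}(x)=(\beta-x)^a(x-\alpha)^b\rho(x)^s$ on $[\alpha,\beta]$, and $R_n^{(a,b,s)}$ ($n\ge0$) are the orthonormal polynomials (degree $n$, positive leading coefficient) for this weight. $w_P^{(d,c)}(y)=(\delta-y)^d(y-\gamma)^c$ on $[\gamma,\delta]$, with orthonormal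 polynomials $\widetilde P_n^{(d,c)}$ (shifted normalised Jacobi polynomials, positive leading coefficient), which satisfy $\frac{\mathrm d}{\mathrm dy}\widetilde P_n^{(d,c)}=d_{n-1}^{(d+1,c+1)}\widetilde P_{n-1}^{(d+1,c+1)}$; this defines the constants $d_{n-1}^{(d+1,c+1)}$. The generalised Koornwinder polynomials are $$H_{n,k}^{(a,b,c,d)}(x,y)=R_{n-k}^{(a,b,c+d+2k+1)}(x)\,\rho(x)^k\,\widetilde P_k^{(d,c)}(y/\rho(x)),\quad 0\le k\le n,$$ orthonormal on $\Omega$ with respect to $W^{(a,b,c,d)}(x,y)=(\beta-x)^a(x-\alpha)^b(y-\gamma\rho(x))^c(\delta\rho(x)-y)^d$. $\mathbf H^{(a,b,c,d)}$ is the infinite row vector of all $H_{n,k}^{(a,b,c,d)}$, ordered in blocks $n=0,1,2,\dots$, block $n$ being $(H_{n,0},\dots,H_{n,n})$. Conventions. $A_{[i,j]}$ is the entry in row $i+1$, column $j+1$ of $A$. A matrix has bandwidths $(\sigma,\mu)$ if $A_{[i,j]}=0$ whenever $i-j>\sigma$ or $j-i>\mu$ ($\sigma$ or $\mu$ may be negative); block-bandwidths are defined in the same way, with block $(i,j)$ (of size $(i+1)\times(j+1)$) in place of entry $[i,j]$, and ''each block has bandwidths'' refers to bandwidths within the blocks. *)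

(* Defs.v *)
From HB Require Import structures.
From mathcomp Require Import all_boot all_order all_algebra.
From mathcomp Require Import all_classical all_reals all_analysis.
Set Implicit Arguments.
Unset Strict Implicit.
Unset Printing Implicit Defensive.
Import Order.TTheory GRing.Theory Num.Theory.
Import numFieldNormedType.Exports.
Local Open Scope classical_set_scope.
Local Open Scope ring_scope.

Definition orthonormal_polys (R : realType) (l r : R) (w : R -> R)
    (p : nat -> {poly R}) : Prop :=
  [/\ forall n, size (p n) = n.+1,
      forall n, 0 < lead_coef (p n)
    & forall m n, (\int[lebesgue_measure]_(x in `[l, r])
        ((p m).[x] * (p n).[x] * w x)%:E)%E = ((m == n)%:R)%:E].

(* The conditions above determine the sequence; the default value 0 is only
   reached for weights that have no orthonormal polynomials. *)
Definition orthopoly (R : realType) (l r : R) (w : R -> R) :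
    nat -> {poly R} :=
  xget (fun=> 0) [set p | orthonormal_polys l r w p].

Definition wR (R : realType) (alpha beta : R) (rho : R -> R) (a b s x : R) : R :=
  (beta - x) `^ a * (x - alpha) `^ b * rho x `^ s.

Definition Rpoly (R : realType) (alpha beta : R) (rho : R -> R) (a b s : R) :
    nat -> {poly R} :=
  orthopoly alpha beta (wR alpha beta rho a b s).

Definition wP (R : realType) (gamma delta : R) (d c y : R) : R :=
  (delta - y) `^ d * (y - gamma) `^ c.

Definition Ptilde (R : realType) (gamma delta : R) (d c : R) :
    nat -> {poly R} :=
  orthopoly gamma delta (wP gamma delta d c).

(* The constant d_m^(d',c') of
   (P_(m+1)^(d'-1,c'-1))' = d_m^(d',c') P_m^(d',c'). *)
Definition dP (R : realType) (gamma delta : R) (m : nat) (d' c' : R) : R :=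
  xget 0 [set t | deriv (Ptilde gamma delta (d' - 1) (c' - 1) m.+1) =
                  t *: Ptilde gamma delta d' c' m].

(* rho^k P_k(y / rho) is written as the polynomial sum_j P_kj y^j rho^(k-j) in
   y and rho, so that it also has the right value, and the right derivative in
   y, at end points x with rho x = 0; see koornwinderE. *)
Definition koornwinder (R : realType) (alpha beta gamma delta : R)
    (rho : R -> R) (a b c d : R) (n k : nat) (x y : R) : R :=
  (Rpoly alpha beta rho a b (c + d + k.*2%:R + 1) (n - k)).[x] *
  \sum_(j < k.+1) (Ptilde gamma delta d c k)`_j * y ^+ j * rho x ^+ (k - j).

Lemma size_orthopoly (R : realType) (l r : R) (w : R -> R) (n : nat) :
  (size (orthopoly l r w n) <= n.+1)%N.
Proof.
rewrite /orthopoly; case: xgetP => [p _ [sp _ _]|_]; first by rewrite sp.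
by rewrite size_poly0.
Qed.

Lemma koornwinderE (R : realType) (alpha beta gamma delta : R)
    (rho : R -> R) (a b c d : R) (n k : nat) (x y : R) :
  rho x != 0 ->
  koornwinder alpha beta gamma delta rho a b c d n k x y =
  (Rpoly alpha beta rho a b (c + d + k.*2%:R + 1) (n - k)).[x] *
  rho x ^+ k * (Ptilde gamma delta d c k).[y / rho x].
Proof.
move=> rx0; rewrite /koornwinder -mulrA; congr (_ * _).
rewrite (horner_coef_wide _ (size_orthopoly _ _ _ k)) mulr_sumr.
apply: eq_bigr => j _.
have jk : (j <= k)%N by rewrite -ltnS ltn_ord.
have -> : rho x ^+ k = rho x ^+ (k - j) * rho x ^+ j by rewrite -exprD subnK.
rewrite expr_div_n [RHS]mulrC -!mulrA.
by congr (_ * (_ * _)); rewrite mulrCA mulVf ?mulr1// expf_neq0.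
Qed.

Definition Omega (R : realType) (alpha beta gamma delta : R) (rho : R -> R) :
    set (R * R) :=
  [set z | alpha <= z.1 <= beta /\ gamma * rho z.1 <= z.2 <= delta * rho z.1].

Definition wW (R : realType) (alpha beta gamma delta : R) (rho : R -> R)
    (a b c d : R) (z : R * R) : R :=
  (beta - z.1) `^ a * (z.1 - alpha) `^ b *
  (z.2 - gamma * rho z.1) `^ c * (delta * rho z.1 - z.2) `^ d.

Definition weights_integrable (R : realType) (alpha beta gamma delta : R)
    (rho : R -> R) (a b c d : R) : Prop :=
  [/\ forall k : nat, lebesgue_measure.-integrable `[alpha, beta]
        (fun x => (wR alpha beta rho a b (c + d + k.*2%:R + 1) x)%:E),
      lebesgue_measure.-integrable `[gamma, delta]
        (fun y => (wP gamma delta d c y)%:E)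
    & (lebesgue_measure \x lebesgue_measure)%E.-integrable
        (Omega alpha beta gamma delta rho)
        (fun z => (wW alpha beta gamma delta rho a b c d z)%:E)].

Definition case_i (R : realType) (alpha beta : R) (rho : R -> R) : Prop :=
  exists p : {poly R}, (2 <= (size p).-1)%N /\
    forall x, alpha <= x <= beta -> rho x = p.[x].

Definition case_ii (R : realType) (alpha beta gamma delta : R) (rho : R -> R)
    (c d : R) : Prop :=
  [/\ exists q : {poly R}, (3 <= (size q).-1)%N /\
        forall x, alpha <= x <= beta -> 0 <= q.[x] /\ rho x = Num.sqrt q.[x],
      delta = - gamma, 0 < delta & c = d].

(* Infinite matrices are families of blocks, block (i, j) being
   (i + 1) x (j + 1). *)
Definition block_matrix (R : realType) : Type :=
  forall i j : nat, 'M[R]_(i.+1, j.+1).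

Definition bandwidths (R : realType) (m n : nat) (A : 'M[R]_(m, n))
    (sigma mu : int) : Prop :=
  forall (i : 'I_m) (j : 'I_n),
    sigma < (i : nat)%:Z - (j : nat)%:Z \/ mu < (j : nat)%:Z - (i : nat)%:Z ->
    A i j = 0.

Definition block_bandwidths (R : realType) (A : block_matrix R)
    (sigma mu : int) : Prop :=
  forall i j : nat, sigma < i%:Z - j%:Z \/ mu < j%:Z - i%:Z -> A i j = 0.

Definition koornwinder_block (R : realType) (alpha beta gamma delta : R)
    (rho : R -> R) (a b c d : R) (n : nat) (x y : R) : 'rV[R]_n.+1 :=
  \row_(k < n.+1) koornwinder alpha beta gamma delta rho a b c d n k x y.

(* The columns of D are finitely supported: this is what gives a meaning to
   the product of the infinite row vector H^(a,b,c+1,d+1) with D. *)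
Definition is_Dy (R : realType) (alpha beta gamma delta : R)
    (rho : R -> R) (a b c d : R) (D : block_matrix R) : Prop :=
  forall j : nat, exists N : nat,
    (forall i, (N <= i)%N -> D i j = 0) /\
    forall (x y : R) (q : 'I_j.+1), Omega alpha beta gamma delta rho (x, y) ->
      is_derive y 1
        (fun t => koornwinder_block alpha beta gamma delta rho a b c d j x t 0 q)
        ((\sum_(i < N) koornwinder_block alpha beta gamma delta rho
             a b (c + 1) (d + 1) i x y *m D i j) 0 q).

(* Main.v *)
Require Import Defs.
From HB Require Import structures.
From mathcomp Require Import all_boot all_order all_algebra.
From mathcomp Require Import all_classical all_reals all_analysis.
From mathcomp Require Import zify ring.
Set Implicit Arguments.
Unset Strict Implicit.
Unset Printing Implicit Defensive.
Import Order.TTheory GRing.Theory Num.Theory.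
Import numFieldNormedType.Exports.
Local Open Scope classical_set_scope.
Local Open Scope ring_scope.

(** The factor of [H_(n,k)] that depends on [y] is the homogenization
    [\sum_j P_j y^j rho^(k-j)] of the Jacobi polynomial [P = P_k].  The [y]
    derivative of a homogenization is the homogenization of [P'] one degree
    lower ([deriv_homogenizationS]), so the formula for [dH/dy] reduces to
    [P_(k+1)^(d,c)' = t P_k^(d+1,c+1)] ([deriv_Ptilde]); the factors
    [R_(n-k)] match because [c + d + 2(k+1) + 1 = (c+1) + (d+1) + 2k + 1].

    The Jacobi identity is the classical one: [P_(k+1)'] has degree [k] and is
    orthogonal, for the weight with raised exponents, to every polynomial [r] of
    lower degree.  To see this one integrates by parts; in terms of the weight
    [w] and [sigma = (delta - y)(y - gamma)] this says that
    [\int (sigma q' + tau q) w = 0] for every polynomial [q]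
    ([jacobi_pearson]), which is applied to [q = P_(k+1) r]
    ([orthogonal_deriv]).  As [c] and [d] may be negative, the integrand can be
    unbounded at the end points, so the fundamental theorem is needed for an
    integrable derivative of a function that is continuous up to the boundary
    ([integrable_FTC2]).

    The matrix [D_y] read off from the formula has the stated bandwidths.  It is
    the only one, since the [H_(n,k)^(a,b,c+1,d+1)] are linearly independent on
    [Omega] ([koornwinder_free]): with [y = t rho(x)] the variables separate,
    and in each variable the polynomials have pairwise distinct degrees.  Those
    degrees are known because the orthonormal polynomials exist, by
    Gram-Schmidt, for every integrable weight that is positive on the open
    interval ([orthopoly_weight]). *)

(** * Orthogonality for a positive definite functional on polynomials *)

Lemma size_subXn (R : nzRingType) (n : nat) (g : {poly R}) :
  (size g <= n)%N -> size ('X^n - g) = n.+1.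
Proof. by move=> gn; rewrite size_polyDl ?size_polyXn// size_polyN ltnS. Qed.

(** The elimination step of Gram-Schmidt: a member [e] of the family with top
    coefficient 1 lowers the degree bound. *)
Lemma size_sub_top (R : idomainType) (n : nat) (r e : {poly R}) :
  (size r <= n.+1)%N -> (size e <= n.+1)%N -> e`_n = 1 ->
  (size (r - r`_n *: e)%R <= n)%N.
Proof.
move=> rn en e1; apply/leq_sizeP => j; rewrite leq_eqVlt coefB coefZ.
case/predU1P => [<-|nj]; first by rewrite e1 mulr1 subrr.
rewrite (nth_default _ (leq_trans rn nj)) (nth_default _ (leq_trans en nj)).
by rewrite mulr0 subr0.
Qed.

Section orthogonality.
Variables (R : rcfType) (L : {scalar {poly R}}).
Hypothesis Lpos : forall p, p != 0 -> 0 < L (p * p).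

Let LZ a p : L (a *: p) = a * L p. Proof. exact: linearZ. Qed.

(** Gram-Schmidt by induction on [n]: the residual [e] of ['X^n] is
    orthogonal to all lower degrees, and adding the component of [f] along
    [e] extends the projection by one dimension. *)
Lemma orthogonal_projection (n : nat) (f : {poly R}) :
  exists2 g : {poly R}, (size g <= n)%N &
    forall r : {poly R}, (size r <= n)%N -> L ((f - g) * r) = 0.
Proof.
elim: n => [|n IH] in f *.
  exists 0; first by rewrite size_poly0.
  by move=> r; rewrite leqn0 size_poly_eq0 => /eqP->; rewrite mulr0 linear0.
have [g gn gf] := IH f.
have [e [sze ene eo]] : exists e : {poly R}, [/\ size e = n.+1, e`_n = 1
    & forall r : {poly R}, (size r <= n)%N -> L (e * r) = 0].
  have [h hn hX] := IH 'X^n; exists ('X^n - h); split => //.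
    exact: size_subXn.
  by rewrite coefB coefXn eqxx nth_default ?subr0.
have e0 : e != 0 by rewrite -size_poly_eq0 sze.
set c := L (f * e) / L (e * e); exists (g + c *: e).
  rewrite (leq_trans (size_polyD _ _))// geq_max (leq_trans gn)//=.
  by rewrite (leq_trans (size_scale_leq _ _))// sze.
move=> r rn; have szr : (size e <= n.+1)%N by rewrite sze.
rewrite -(subrK (r`_n *: e) r); set r' := r - _; set t := r`_n.
have r'n : (size r' <= n)%N by exact: size_sub_top.
have -> : (f - (g + c *: e)) * (r' + t *: e) =
    (f - g) * r' - c *: (e * r') + t *: (f * e - e * g - c *: (e * e)).
  by rewrite -!mul_polyC; ring.
rewrite linearD linearB !LZ gf// eo// !linearB/= LZ.
by rewrite (eo g)// mulr0 !subr0 add0r divfK ?subrr ?mulr0// gt_eqF// Lpos.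
Qed.

Lemma exists_orthonormal : exists p : nat -> {poly R},
  [/\ forall n, size (p n) = n.+1, forall n, 0 < lead_coef (p n)
    & forall m n, L (p m * p n) = (m == n)%:R].
Proof.
have /choice[e ee] (n : nat) : exists e : {poly R},
    [/\ size e = n.+1, lead_coef e = 1
      & forall r : {poly R}, (size r <= n)%N -> L (e * r) = 0].
  have [g gn gX] := orthogonal_projection n 'X^n.
  exists ('X^n - g); split => //; first exact: size_subXn.
  by rewrite lead_coefE size_subXn//= coefB coefXn eqxx nth_default ?subr0.
have epos n : 0 < L (e n * e n).
  by have [se _ _] := ee n; rewrite Lpos// -size_poly_eq0 se.
pose c n := (Num.sqrt (L (e n * e n)))^-1.
have cpos n : 0 < c n by rewrite invr_gt0 sqrtr_gt0.
have eorth m n : (m < n)%N -> L (e m * e n) = 0.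
  have [_ _ en] := ee n; have [sm _ _] := ee m.
  by move=> mn; rewrite mulrC en// sm.
exists (fun n => c n *: e n); split=> [n|n|m n].
- by have [se _ _] := ee n; rewrite size_scale ?gt_eqF.
- by have [_ le _] := ee n; rewrite lead_coefZ le mulr1.
rewrite -scalerAl -scalerAr !LZ.
have [mn|nm|->] := ltngtP m n.
- by rewrite (eorth m n)// !mulr0.
- by rewrite (mulrC (e m)) (eorth n m)// !mulr0.
rewrite mulrA /c -invfM -expr2 sqr_sqrtr ?mulVf// ?gt_eqF//; exact: ltW.
Qed.

Lemma orthonormal_lower (p : nat -> {poly R}) :
  (forall n, size (p n) = n.+1) ->
  (forall m n, L (p m * p n) = (m == n)%:R) ->
  forall (n : nat) (r : {poly R}), (size r <= n)%N -> L (p n * r) = 0.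
Proof.
move=> sp op n; suff H m (r : {poly R}) :
    (m <= n)%N -> (size r <= m)%N -> L (p n * r) = 0 by move=> r; exact: H.
elim: m r => [|m IH] r mn.
  by rewrite leqn0 size_poly_eq0 => /eqP->; rewrite mulr0 linear0.
move=> rm; pose e := (lead_coef (p m))^-1 *: p m.
rewrite -(subrK (r`_m *: e) r) mulrDr linearD/= IH ?(ltnW mn)//; last first.
  have lp : lead_coef (p m) != 0 by rewrite lead_coef_eq0 -size_poly_eq0 sp.
  apply: size_sub_top => //.
    by rewrite (leq_trans (size_scale_leq _ _))// sp.
  by rewrite coefZ; move: lp; rewrite lead_coefE sp/= => lp; rewrite mulVf.
by rewrite /e scalerA -scalerAr LZ op gtn_eqF// mulr0 addr0.
Qed.

(** Subtracting the multiple of [p] that cancels the top coefficient of [q]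
    leaves a polynomial of lower degree orthogonal to itself. *)
Lemma orthogonal_collinear (k : nat) (p q : {poly R}) :
  size p = k.+1 -> (size q <= k.+1)%N ->
  (forall r : {poly R}, (size r <= k)%N -> L (p * r) = 0) ->
  (forall r : {poly R}, (size r <= k)%N -> L (q * r) = 0) ->
  exists t, q = t *: p.
Proof.
move=> sp sq op oq; exists (q`_k / lead_coef p).
have lp : lead_coef p != 0 by rewrite lead_coef_eq0 -size_poly_eq0 sp.
apply/eqP; rewrite -subr_eq0; set t := q`_k / _.
have sd : (size (q - t *: p)%R <= k)%N.
  rewrite /t -scalerA; apply: size_sub_top => //.
    by rewrite (leq_trans (size_scale_leq _ _))// sp.
  by rewrite coefZ; move: lp; rewrite lead_coefE sp/= => lp; rewrite mulVf.
apply/negP => /negP/Lpos; set d := q - t *: p in sd *.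
by rewrite {1}/d mulrBl linearB/= -scalerAl LZ op// oq// mulr0 subr0 ltxx.
Qed.

End orthogonality.

(** If [L] is integration against [w], the hypothesis [L (s q' + e q) = 0] is
    the weak form of the Pearson equation [(s w)' = e w]. Taking [q = P r]
    moves the derivative from [P] to [s r' + e r], whose degree is at most
    [k]. *)
Lemma orthogonal_deriv (R : rcfType) (L L' : {scalar {poly R}})
    (s e P : {poly R}) (k : nat) :
  (size s <= 3)%N -> (size e <= 2)%N ->
  (forall p, L' p = L (s * p)) ->
  (forall q, L (s * q^`() + e * q) = 0) ->
  (forall r : {poly R}, (size r <= k.+1)%N -> L (P * r) = 0) ->
  forall r : {poly R}, (size r <= k)%N -> L' (P^`() * r) = 0.
Proof.
move=> ss se L'E pearson oP r rk.
have [->|r0] := eqVneq r 0; first by rewrite mulr0 linear0.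
have := pearson (P * r); rewrite derivM mulrDr -addrA linearD/= -L'E => /eqP.
rewrite addr_eq0 => /eqP->.
have -> : s * (P * r^`()) + e * (P * r) = P * (s * r^`() + e * r).
  by rewrite mulrDr !(mulrCA P).
rewrite oP ?oppr0// (leq_trans (size_polyD _ _))// geq_max; apply/andP; split.
  by have := size_polyMleq s r^`(); have := lt_size_deriv r0; lia.
by have := size_polyMleq e r; lia.
Qed.

(** * Integration against a weight on an interval *)

Lemma finite_roots (R : realType) (p : {poly R}) :
  p != 0 -> finite_set [set x | root p x].
Proof.
move=> p0; apply: contrapT => /(@infinite_set_fset _ _ (size p))[B Bp sB].
have := @max_poly_roots _ p (finmap.enum_fset B) p0.
rewrite finmap.fset_uniq ltnNge sB => H.
by suff : false by []; apply: H => //; apply/allP => x xB; exact: Bp.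
Qed.

Lemma poly0_itvoo (R : realType) (l r : R) (p : {poly R}) :
  l < r -> (forall x, l < x < r -> p.[x] = 0) -> p = 0.
Proof.
move=> lr p0; apply/eqP/negP => /negP/finite_roots fin.
have : finite_set [set` `]l, r[].
  by apply: sub_finite_set fin => x /=; rewrite in_itv/= => /p0/rootP.
move/finite_set_countable/countable_lebesgue_measure0 => /eqP.
by rewrite lebesgue_measure_itv/= lte_fin lr -EFinB eqe subr_eq0 gt_eqF.
Qed.

Lemma integrable_horner_weight (R : realType) (l r : R) (w : R -> R)
    (p : {poly R}) :
  lebesgue_measure.-integrable `[l, r] (fun x => (w x)%:E) ->
  lebesgue_measure.-integrable `[l, r] (fun x => (p.[x] * w x)%:E).
Proof.
move=> iw; have cp : {within `[l, r], continuous (horner p)}.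
  by apply: continuous_subspaceT; exact: continuous_horner.
have -> : (fun x => (p.[x] * w x)%:E) = ((EFin \o horner p) \* (EFin \o w))%E.
  by apply/funext => x /=; rewrite EFinM.
apply: integrableMr => //; first exact: measurable_poly.
have /compact_bounded[M [_ mrt]] := continuous_compact cp (@segment_compact _ l r).
by exists M; split; rewrite ?num_real // => ? ? ? ?; exact: mrt.
Qed.

(** Definiteness: if [\int p^2 w = 0] then [p^2 w] vanishes almost
    everywhere, so the open interval is covered by a null set and the
    finitely many roots of [p]. *)
Lemma weight_functional (R : realType) (l r : R) (w : R -> R) :
  l < r -> lebesgue_measure.-integrable `[l, r] (fun x => (w x)%:E) ->
  (forall x, 0 <= w x) -> (forall x, l < x < r -> 0 < w x) ->
  exists L : {scalar {poly R}},
    (forall p, (\int[lebesgue_measure]_(x in `[l, r])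
      (p.[x] * w x)%:E)%E = (L p)%:E)
    /\ forall p, p != 0 -> 0 < L (p * p).
Proof.
move=> lr iw w0 wpos.
pose I (p : {poly R}) := \int[lebesgue_measure]_(x in `[l, r]) (p.[x] * w x).
have Ilin : scalar I.
  move=> k p q; rewrite /I -RintegralZl//; last exact: integrable_horner_weight.
  rewrite -RintegralD//; last exact: integrable_horner_weight.
    by apply: eq_Rintegral => x _; rewrite hornerD hornerZ; ring.
  rewrite (_ : _ \o _ = fun x => ((k *: p).[x] * w x)%:E).
    exact: integrable_horner_weight.
  by apply/funext => x /=; rewrite hornerZ mulrA.
pose L : {scalar {poly R}} := HB.pack I (GRing.isLinear.Build _ _ _ _ I Ilin).
have IE p : (\int[lebesgue_measure]_(x in `[l, r]) (p.[x] * w x)%:E)%E = (L p)%:E.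
  rewrite /L/= /I /Rintegral fineK//; apply: integrable_fin_num => //.
  exact: integrable_horner_weight.
exists L; split => // p p0.
have f0 x : 0 <= (p * p).[x] * w x by rewrite hornerM mulr_ge0 ?sqr_ge0.
rewrite lt_neqAle [X in _ && X]Rintegral_ge0 ?andbT//.
apply/eqP => Lp0.
have : (\int[lebesgue_measure]_(x in `[l, r]) `|((p * p).[x] * w x)%:E|)%E = 0%E.
  under eq_integral do rewrite abse_EFin ger0_norm//.
  by rewrite IE -Lp0.
move/ae_eq_integral_abs => /= []//.
  by case/integrableP: (integrable_horner_weight (p * p) iw).
move=> N [mN N0 sub].
have mroot : measurable [set x | root p x].
  apply: countable_measurable => //; apply: finite_set_countable.
  exact: finite_roots.
have : (lebesgue_measure (`]l, r[ : set R) <= 0)%E.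
  rewrite -[leRHS](_ : lebesgue_measure (N `|` [set x | root p x]) = 0%E).
    apply: le_measure; rewrite ?inE//; first exact: measurableU.
    move=> x /=; rewrite in_itv/= => /andP[lx xr].
    have [px|px] := eqVneq p.[x] 0; [by right; exact/rootP|left].
    apply: sub => /= H; have /eqP : ((p * p).[x] * w x)%:E = 0%E :> \bar R.
      by apply: H; rewrite in_itv/= !ltW.
    by rewrite eqe hornerM !mulf_eq0 (negPf px)/= gt_eqF// wpos ?lx.
  rewrite measureU0//; apply: countable_lebesgue_measure0.
  by apply: finite_set_countable; exact: finite_roots.
by rewrite lebesgue_measure_itv/= lte_fin lr -EFinB lee_fin subr_le0 leNgt lr.
Qed.

Lemma orthopoly_weight (R : realType) (l r : R) (w : R -> R) :
  l < r -> lebesgue_measure.-integrable `[l, r] (fun x => (w x)%:E) ->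
  (forall x, 0 <= w x) -> (forall x, l < x < r -> 0 < w x) ->
  orthonormal_polys l r w (orthopoly l r w).
Proof.
move=> lr iw w0 wpos; apply: xgetPex.
have [L [LE Lpos]] := weight_functional lr iw w0 wpos.
have [p [sp lp op]] := exists_orthonormal Lpos.
exists p; split=> // m n.
by under eq_integral do rewrite -hornerM; rewrite LE op.
Qed.

Lemma orthonormal_polys_lower (R : realType) (l r : R) (w : R -> R)
    (L : {scalar {poly R}}) (p : nat -> {poly R}) :
  (forall q, (\int[lebesgue_measure]_(x in `[l, r])
    (q.[x] * w x)%:E)%E = (L q)%:E) ->
  orthonormal_polys l r w p ->
  forall (n : nat) (q : {poly R}), (size q <= n)%N -> L (p n * q) = 0.
Proof.
move=> LE [sp _ op]; apply: orthonormal_lower => // m n.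
apply: EFin_inj; rewrite -LE -op.
by apply: eq_integral => x _; rewrite hornerM.
Qed.

(** * The fundamental theorem of calculus for an integrable derivative *)

(** With [G] the indefinite integral of [f], the difference [G - F] is
    continuous on the closed interval and has derivative zero inside, so it
    takes the same value at both ends; [f] may be unbounded near the ends. *)
Lemma integrable_FTC2 (R : realType) (F f : R -> R) (l r : R) :
  l < r -> lebesgue_measure.-integrable `[l, r] (EFin \o f) ->
  (forall x : R, x \in `]l, r[ -> is_derive x 1 F (f x)) ->
  {in `]l, r[, continuous f} ->
  {within `[l, r], continuous F} ->
  \int[lebesgue_measure]_(x in `[l, r]) f x = F r - F l.
Proof.
move=> lr intf dF cf cF.
pose G x := \int[lebesgue_measure]_(t in `[l, x]) f t.
have cG : {within `[l, r], continuous G}.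
  exact: (parameterized_integral_continuous (ltW lr) intf).
have dG x : x \in `]l, r[ -> is_derive x 1 G (f x).
  move=> xlr; have /andP[lx xr] : l < x < r by move: xlr; rewrite in_itv/=.
  have [dGx <-] := continuous_FTC1_closed xr intf lx (cf _ xlr).
  by apply: DeriveDef; [exact: dGx|rewrite derive1E].
have dH x : x \in `]l, r[ -> is_derive x 1 (G - F) ((fun=> 0) x).
  move=> xlr; have dGx := dG x xlr; have dFx := dF x xlr.
  by rewrite -(subrr (f x)); exact: is_deriveB.
have cH : {within `[l, r], continuous (G - F)}.
  by move=> x; apply: continuousB; [exact: cG|exact: cF].
have [z _] := MVT lr dH cH; rewrite mul0r => /eqP.
rewrite subr_eq0 => /eqP; rewrite !fctE.
have -> : G l = 0 by rewrite /G set_itv1 Rintegral_set1.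
by rewrite sub0r => /eqP; rewrite subr_eq addrC => /eqP <-.
Qed.

(** On negative numbers the real power is not small near zero; the absolute
    value gives a version that is continuous on the whole line, which avoids
    one-sided limits. *)
Lemma continuous_powR_norm (R : realType) (s : R) :
  0 < s -> continuous (fun y : R => `|y| `^ s).
Proof.
move=> s0 y; have [->|y0] := eqVneq y 0.
  apply/cvgrPdist_lt => e e0; near=> z.
  rewrite normr0 powR0 ?gt_eqF// sub0r normrN ger0_norm ?powR_ge0//.
  have -> : e = (e `^ s^-1) `^ s by rewrite -powRrM mulVf ?gt_eqF// powRr1// ltW.
  rewrite gt0_ltr_powR// ?nnegrE ?powR_ge0//.
  by near: z; apply: (@nbhs0_lt R R); exact: powR_gt0.
apply: (@continuous_comp R R R (fun z : R => `|z|) (fun z : R => z `^ s) y).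
  exact: norm_continuous.
apply/differentiable_continuous/derivable1_diffP.
by apply: derivable_powR; rewrite in_itv/= andbT normr_gt0.
Unshelve. all: by end_near. Qed.

(** * Jacobi polynomials *)

Lemma powRS (R : realType) (x s : R) :
  0 <= x -> -1 < s -> x `^ (s + 1) = x * x `^ s.
Proof.
move=> x0 s1; rewrite -[in RHS](addrK 1 s) mulr_powRB1//.
by rewrite -ltrBlDr sub0r.
Qed.

(** [jacobi_sigma] and [jacobi_tau] are the coefficients of the Pearson
    equation [(sigma w)' = tau w] of the Jacobi weight. *)
Definition jacobi_sigma (R : realType) (gamma delta : R) : {poly R} :=
  (delta%:P - 'X) * ('X - gamma%:P).

Definition jacobi_tau (R : realType) (gamma delta d c : R) : {poly R} :=
  (c + 1) *: (delta%:P - 'X) - (d + 1) *: ('X - gamma%:P).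

Section jacobi.
Variables (R : realType) (gamma delta d c : R).
Hypotheses (gd : gamma < delta) (d1 : -1 < d) (c1 : -1 < c).
Local Notation w := (wP gamma delta d c).
Local Notation w' := (wP gamma delta (d + 1) (c + 1)).
Local Notation sigma := (jacobi_sigma gamma delta).
Local Notation tau := (jacobi_tau gamma delta d c).

Lemma wP_ge0 e f y : 0 <= wP gamma delta e f y.
Proof. by rewrite mulr_ge0 ?powR_ge0. Qed.

Lemma wP_gt0 e f y : gamma < y < delta -> 0 < wP gamma delta e f y.
Proof. by move=> /andP[gy yd]; rewrite mulr_gt0 ?powR_gt0 ?subr_gt0. Qed.

Lemma wPS y : gamma <= y <= delta -> w' y = sigma.[y] * w y.
Proof.
move=> /andP[gy yd]; rewrite /wP !powRS ?subr_ge0//.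
by rewrite /jacobi_sigma hornerM !hornerE /=; ring.
Qed.

Lemma derive_wP e f y : gamma < y < delta ->
  is_derive y 1 (wP gamma delta e f)
    (f * wP gamma delta e (f - 1) y - e * wP gamma delta (e - 1) f y).
Proof.
move=> /andP[gy yd].
have dl : 0 < (delta%:P - 'X).[y] by rewrite !hornerE subr_gt0.
have dr : 0 < ('X - gamma%:P).[y] by rewrite !hornerE subr_gt0.
have hl := is_derive1_comp (is_derive1_powR e dl)
  (is_derive_poly (delta%:P - 'X) y).
have hr := is_derive1_comp (is_derive1_powR f dr)
  (is_derive_poly ('X - gamma%:P) y).
have := is_deriveM hl hr.
have -> : ((powR (R:=R))^~ e \o horner (delta%:P - 'X)) *
    ((powR (R:=R))^~ f \o horner ('X - gamma%:P)) = wP gamma delta e f.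
  by apply/funext => z; rewrite /wP !fctE /= !hornerE.
move=> h; apply: is_derive_eq h _.
by rewrite /wP !derivB !derivC !derivX /GRing.scale/= !hornerE /=; ring.
Qed.

Lemma derive_wPS y : gamma < y < delta -> is_derive y 1 w' (tau.[y] * w y).
Proof.
move=> yi; apply: is_derive_eq (derive_wP _ _ yi) _.
case/andP: yi => gy yd; rewrite !addrK /wP !powRS ?subr_ge0 ?(ltW gy) ?(ltW yd)//.
by rewrite /jacobi_tau !hornerE /=; ring.
Qed.

Lemma continuous_wPS : {within `[gamma, delta], continuous w'}.
Proof.
have c0 s : -1 < s -> 0 < s + 1 by rewrite -ltrBlDr sub0r.
pose W y := `|delta - y| `^ (d + 1) * `|y - gamma| `^ (c + 1).
apply: (subspace_eq_continuous (f := W)) => [y|].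
  rewrite inE/= in_itv/= => /andP[gy yd].
  by rewrite /W /wP !ger0_norm ?subr_ge0.
apply: continuous_subspaceT => y; apply: cvgM.
  apply: (@continuous_comp R R R (fun z => delta - z)
    (fun z => `|z| `^ (d + 1)) y).
    by apply: cvgB; [exact: cvg_cst|exact: cvg_id].
  exact/continuous_powR_norm/c0.
apply: (@continuous_comp R R R (fun z => z - gamma)
  (fun z => `|z| `^ (c + 1)) y).
  by apply: cvgB; [exact: cvg_id|exact: cvg_cst].
exact/continuous_powR_norm/c0.
Qed.

Lemma continuous_wP y : gamma < y < delta -> {for y, continuous w}.
Proof.
move=> yi; apply/differentiable_continuous/derivable1_diffP.
by have [] := derive_wP d c yi.
Qed.

Hypothesis iw : lebesgue_measure.-integrable `[gamma, delta]
  (fun y => (w y)%:E).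

Lemma integrable_wPS :
  lebesgue_measure.-integrable `[gamma, delta] (fun y => (w' y)%:E).
Proof.
apply: eq_integrable (integrable_horner_weight sigma iw) => //.
by move=> y; rewrite inE/= in_itv/= => yi; rewrite wPS.
Qed.

(** The integrand is the derivative of [sigma w q], and [sigma w], the weight
    with raised exponents, vanishes at both ends. *)
Lemma jacobi_pearson (q : {poly R}) :
  \int[lebesgue_measure]_(y in `[gamma, delta])
    ((sigma * q^`() + tau * q).[y] * w y) = 0.
Proof.
have wend y : y = gamma \/ y = delta -> w' y = 0.
  by case=> ->; rewrite wPS ?lexx ?(ltW gd)// /jacobi_sigma hornerM !hornerE /=
    subrr ?mulr0 !mul0r.
transitivity ((w' * horner q) delta - (w' * horner q) gamma); last first.
  by rewrite !fctE !wend ?mul0r ?subrr; [|left|right].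
apply: integrable_FTC2 => //.
- exact: integrable_horner_weight.
- move=> y; rewrite in_itv/= => yi.
  have h := is_deriveM (derive_wPS yi) (is_derive_poly q y).
  apply: is_derive_eq h _; rewrite wPS; last by case/andP: yi => /ltW-> /ltW->.
  by move: (sigma) (tau) => s t; rewrite hornerD !hornerM /GRing.scale/=; ring.
- move=> y; rewrite in_itv/= => yi; apply: cvgM; last exact: continuous_wP.
  exact: continuous_horner.
- move=> y; apply: continuousM; first exact: continuous_wPS.
  by apply: continuous_subspaceT; exact: continuous_horner.
Qed.

Lemma Ptilde_orthonormal :
  orthonormal_polys gamma delta w (Ptilde gamma delta d c).
Proof. by apply: orthopoly_weight => // y; [exact: wP_ge0|exact: wP_gt0]. Qed.

End jacobi.

(** The derivative has degree [k] and is orthogonal to lower degrees for the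
    weight with raised exponents, hence it is collinear with the Jacobi
    polynomial of degree [k] of that weight. *)
Lemma deriv_Ptilde (R : realType) (gamma delta d c : R) (k : nat) :
  gamma < delta -> -1 < d -> -1 < c ->
  lebesgue_measure.-integrable `[gamma, delta]
    (fun y => (wP gamma delta d c y)%:E) ->
  (Ptilde gamma delta d c k.+1)^`() =
  dP gamma delta k (d + 1) (c + 1) *: Ptilde gamma delta (d + 1) (c + 1) k.
Proof.
move=> gd d1 c1 iw; have iw' := integrable_wPS d1 c1 iw.
have [L [LE Lpos]] := weight_functional gd iw (wP_ge0 _ _ _ _)
  (@wP_gt0 _ _ _ _ _).
have [L' [LE' Lpos']] := weight_functional gd iw' (wP_ge0 _ _ _ _)
  (@wP_gt0 _ _ _ _ _).
have LL p : L' p = L (jacobi_sigma gamma delta * p).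
  apply: EFin_inj; rewrite -LE -LE'; apply: eq_integral => y.
  rewrite inE/= in_itv/= => yi.
  by rewrite wPS// (hornerM (jacobi_sigma _ _) p) mulrCA mulrA.
have LP q :
    L (jacobi_sigma gamma delta * q^`() + jacobi_tau gamma delta d c * q) = 0.
  by have := jacobi_pearson gd d1 c1 iw q; rewrite /Rintegral LE.
have oP := Ptilde_orthonormal gd iw; have [sP _ _] := oP.
have oP' := Ptilde_orthonormal gd iw'; have [sP' _ _] := oP'.
suff [t Pt] : exists t, (Ptilde gamma delta d c k.+1)^`() =
    t *: Ptilde gamma delta (d + 1) (c + 1) k.
  rewrite /dP !addrK.
  by case: xgetP => [u _ ->//|/(_ t)]; rewrite /= Pt.
apply: (orthogonal_collinear Lpos' (k := k)) => //.
- by rewrite -ltnS -(sP k.+1) lt_size_deriv// -size_poly_eq0 sP.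
- exact: orthonormal_polys_lower LE' oP' k.
apply: (orthogonal_deriv (L := L) (s := jacobi_sigma gamma delta)
    (e := jacobi_tau gamma delta d c)) => //.
- rewrite (leq_trans (size_polyMleq _ _))// -opprB size_polyN !size_XsubC.
  by [].
- rewrite (leq_trans (size_polyD _ _))// geq_max size_polyN -opprB.
  by rewrite !(leq_trans (size_scale_leq _ _)) ?size_polyN ?size_XsubC.
- exact: orthonormal_polys_lower LE oP k.+1.
Qed.

(** * Derivatives of the generalised Koornwinder polynomials *)

(** For [p] of degree at most [k] and [r] nonzero this is [r^k p(y / r)] as a
    polynomial in [y]. *)
Definition homogenization (R : nzRingType) (k : nat) (p : {poly R}) (r : R) :
    {poly R} :=
  \poly_(j < k.+1) (p`_j * r ^+ (k - j)).

Lemma coef_homogenization (R : nzRingType) (k : nat) (p : {poly R}) (r : R) j :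
  (homogenization k p r)`_j = if (j <= k)%N then p`_j * r ^+ (k - j) else 0.
Proof. by rewrite coef_poly ltnS. Qed.

Lemma deriv_homogenizationS (R : comNzRingType) (k : nat) (p : {poly R})
    (r : R) :
  (homogenization k.+1 p r)^`() = homogenization k p^`() r.
Proof.
apply/polyP => j; rewrite coef_deriv !coef_homogenization coef_deriv ltnS.
by case: ifP; rewrite ?mul0rn// subSS mulrnAl.
Qed.

Lemma homogenizationZ (R : comNzRingType) (k : nat) (t : R) (p : {poly R})
    (r : R) :
  homogenization k (t *: p) r = t *: homogenization k p r.
Proof.
apply/polyP => j; rewrite coefZ !coef_homogenization coefZ.
by case: ifP; rewrite ?mulr0// mulrA.
Qed.

(** Raising [c] and [d] at index [k] gives the exponent of [rho] that index
    [k + 1] has for the original parameters. This identifies the factors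
    [R_(n-k)] on both sides of the derivative formula, and shows that they
    are orthonormal for an integrable weight. *)
Lemma raised_exponent (R : pzRingType) (c d : R) (k : nat) :
  c + 1 + (d + 1) + k.*2%:R + 1 = c + d + k.+1.*2%:R + 1.
Proof. by rewrite doubleS -[k.*2.+2]add2n natrD !addrA (addrAC c 1). Qed.

Section koornwinder.
Variables (R : realType) (alpha beta gamma delta : R) (rho : R -> R) (a b : R).
Local Notation H := (koornwinder alpha beta gamma delta rho a b).
Local Notation Rp c d k := (Rpoly alpha beta rho a b (c + d + k.*2%:R + 1)).

Lemma koornwinder_horner c d n k x :
  H c d n k x = horner ((Rp c d k (n - k)).[x] *:
    homogenization k (Ptilde gamma delta d c k) (rho x)).
Proof.
apply/funext => y; rewrite hornerZ horner_poly; congr (_ * _).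
by apply: eq_bigr => j _; rewrite mulrAC.
Qed.

Lemma derive_koornwinder0 c d n x (y : R) : is_derive y 1 (H c d n 0 x) 0.
Proof.
rewrite koornwinder_horner; apply: is_derive_eq.
by rewrite derivZ /homogenization poly_def big_ord1/= expr0 derivZ derivC
  scaler0 scaler0 horner0.
Qed.

Lemma derive_koornwinderS c d n k x (y : R) :
  gamma < delta -> -1 < d -> -1 < c ->
  lebesgue_measure.-integrable `[gamma, delta]
    (fun y => (wP gamma delta d c y)%:E) ->
  is_derive y 1 (H c d n k.+1 x)
    (dP gamma delta k (d + 1) (c + 1) * H (c + 1) (d + 1) n.-1 k x y).
Proof.
move=> gd d1 c1 iw; rewrite !koornwinder_horner; apply: is_derive_eq.
rewrite derivZ deriv_homogenizationS deriv_Ptilde// homogenizationZ !hornerZ.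
rewrite mulrCA; congr (_ * (_ * _)).
have -> : (n - k.+1 = n.-1 - k)%N by lia.
by rewrite raised_exponent.
Qed.

End koornwinder.

(** * Linear independence of the generalised Koornwinder polynomials *)

(** The term of largest index with a nonzero coefficient cannot be cancelled,
    having the largest degree. The shift [p] is there for the family
    [R_(i-k)], indexed by [i] at fixed [k]. *)
Lemma graded_polys_free (R : idomainType) (F : nat -> {poly R}) (c : nat -> R)
    (p N : nat) :
  (forall i, c i != 0 -> (p <= i)%N /\ size (F i) = (i - p).+1) ->
  \sum_(i < N) c i *: F i = 0 -> forall i, (i < N)%N -> c i = 0.
Proof.
move=> sF; elim: N => [//|N IH]; rewrite big_ord_recr/= => sum0.
have cN : c N = 0.
  apply/eqP/negP => /negP cN; have [pN szN] := sF N cN.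
  have small : (size (\sum_(i < N) c i *: F i)%R <= N - p)%N.
    apply: (leq_trans (size_sum _ _ _)); apply/bigmax_leqP => i _.
    have [->|ci] := eqVneq (c i) 0; first by rewrite scale0r size_poly0.
    have [pi szi] := sF i ci; rewrite size_scale// szi.
    by have := ltn_ord i; lia.
  have := congr1 (fun q : {poly R} => size q) sum0.
  by rewrite addrC size_polyDl ?size_poly0 size_scale// szN.
move=> i; rewrite ltnS leq_eqVlt => /predU1P[->//|iN]; apply: IH => //.
by move: sum0; rewrite cN scale0r addr0.
Qed.

(** At [y = t rho(x)] a combination becomes [\sum_k (\sum_i e_ik R_(i-k)(x))
    rho(x)^k P_k(t)]: a polynomial identity in [t] for fixed [x], then one in
    [x] for each [k]. *)
Lemma koornwinder_free (R : realType) (alpha beta gamma delta : R)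
    (rho : R -> R) (a b c d : R) (N : nat) (e : nat -> nat -> R) :
  alpha < beta -> gamma < delta ->
  (forall x, alpha < x < beta -> 0 < rho x) ->
  (forall k n, size (Rpoly alpha beta rho a b (c + d + k.*2%:R + 1) n) = n.+1) ->
  (forall n, size (Ptilde gamma delta d c n) = n.+1) ->
  (forall i k, (i < k)%N -> e i k = 0) ->
  (forall x y, Omega alpha beta gamma delta rho (x, y) ->
    \sum_(i < N) \sum_(k < N)
      e i k * koornwinder alpha beta gamma delta rho a b c d i k x y = 0) ->
  forall i k, (i < N)%N -> (k < N)%N -> e i k = 0.
Proof.
move=> ab gd rho0 sR sP elow sum0 i k iN kN.
pose r k i := Rpoly alpha beta rho a b (c + d + k.*2%:R + 1) (i - k).
pose F k := \sum_(i < N) e i k *: r k i.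
suff Fk : F k = 0.
  apply: (graded_polys_free (F := r k) (c := e^~ k) (p := k) _ Fk iN) => m em.
  by split; [rewrite leqNgt; apply: contra_neqN em => /elow|exact: sR].
apply: (poly0_itvoo ab) => x xi; have rx := rho0 x xi.
have : \sum_(k < N) ((F k).[x] * rho x ^+ k) *: Ptilde gamma delta d c k = 0.
  apply: (poly0_itvoo gd) => t /andP[gt td].
  have Om : Omega alpha beta gamma delta rho (x, t * rho x).
    by case/andP: xi => ax xb; split; rewrite /= ?ler_pM2r ?ltW.
  rewrite -(sum0 _ _ Om) exchange_big/= horner_sum; apply: eq_bigr => l _.
  rewrite hornerZ horner_sum !mulr_suml; apply: eq_bigr => m _.
  by rewrite koornwinderE ?gt_eqF// mulfK ?gt_eqF// hornerZ !mulrA.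
move=> /(graded_polys_free (F := Ptilde gamma delta d c)
  (c := fun l => (F l).[x] * rho x ^+ l) (p := 0)).
move=> /(_ _ k kN)/eqP; rewrite mulf_eq0 expf_eq0 (gt_eqF rx) andbF orbF => Fk0.
by apply/eqP/Fk0 => m _; rewrite sP subn0.
Qed.

(** * The matrix of the derivative *)

Section Dy.
Variables (R : realType) (alpha beta gamma delta : R) (rho : R -> R).
Variables (a b c d : R).
Local Notation H := (koornwinder alpha beta gamma delta rho a b).
Local Notation Hblock := (koornwinder_block alpha beta gamma delta rho a b).
Local Notation isDy := (is_Dy alpha beta gamma delta rho a b c d).

(** Extending column [q] of block column [j] by zero to all pairs of natural
    numbers avoids ranges that depend on the block. *)
Definition block_col (D : block_matrix R) (j : nat) (q : 'I_j.+1)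
    (i p : nat) : R :=
  if (p <= i)%N then D i j (inord p) q else 0.

Lemma block_mulE (D : block_matrix R) (j N : nat) (q : 'I_j.+1) x y :
  (\sum_(i < N) Hblock (c + 1) (d + 1) i x y *m D i j) 0 q =
  \sum_(i < N) \sum_(p < N) block_col D q i p * H (c + 1) (d + 1) i p x y.
Proof.
rewrite summxE; apply: eq_bigr => i _; rewrite mxE.
rewrite (eq_bigr (fun p : 'I_i.+1 =>
    block_col D q i p * H (c + 1) (d + 1) i p x y)); last first.
  move=> p _; rewrite mxE /block_col -ltnS ltn_ord mulrC; congr (D i j _ q * _).
  by apply: val_inj; rewrite /= inordK.
rewrite (big_ord_widen N
  (fun p => block_col D q i p * H (c + 1) (d + 1) i p x y))//.
rewrite big_mkcond; apply: eq_bigr => p _; rewrite /block_col ltnS.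
by case: (p <= i)%N; rewrite ?mul0r.
Qed.

(** Any larger cutoff than [N] works too, so that two matrices can be
    compared with a common one. *)
Lemma is_Dy_derive (D : block_matrix R) : isDy D ->
  forall j : nat, exists N : nat,
  (forall i, (N <= i)%N -> D i j = 0) /\
  forall M x y (q : 'I_j.+1), (N <= M)%N ->
    Omega alpha beta gamma delta rho (x, y) ->
    is_derive (y : R) 1 (H c d j q x)
      (\sum_(i < M) \sum_(p < M) block_col D q i p * H (c + 1) (d + 1) i p x y).
Proof.
move=> hD j; have [N [D0 dD]] := hD j; exists N; split=> // M x y q NM Om.
have := dD x y q Om; rewrite -block_mulE.
under eq_fun do rewrite mxE.
suff -> : \sum_(i < N) Hblock (c + 1) (d + 1) i x y *m D i j =
    \sum_(i < M) Hblock (c + 1) (d + 1) i x y *m D i j by [].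
rewrite (big_ord_widen M (fun i => Hblock (c + 1) (d + 1) i x y *m D i j))//.
rewrite big_mkcond; apply: eq_bigr => i _.
by case: ltnP => // /D0->; rewrite mulmx0.
Qed.

Hypotheses (ab : alpha < beta) (gd : gamma < delta).
Hypothesis rho0 : forall x, alpha < x < beta -> 0 < rho x.
Hypotheses (c1 : -1 < c) (d1 : -1 < d).
Hypothesis hint : weights_integrable alpha beta gamma delta rho a b c d.

Let iw : lebesgue_measure.-integrable `[gamma, delta]
  (fun y => (wP gamma delta d c y)%:E).
Proof. by case: hint. Qed.

Lemma size_RpolyS k n :
  size (Rpoly alpha beta rho a b (c + 1 + (d + 1) + k.*2%:R + 1) n) = n.+1.
Proof.
rewrite raised_exponent; have [iR _ _] := hint.
have [|x xi|sR _ _] := orthopoly_weight ab (iR k.+1) _ _; last exact: sR.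
  by move=> x; rewrite !mulr_ge0 ?powR_ge0.
have /andP[ax xb] := xi.
by rewrite !mulr_gt0 ?powR_gt0 ?subr_gt0 ?rho0.
Qed.

(** Derivatives are unique, so the difference of two such matrices gives
    vanishing combinations of linearly independent functions. *)
Lemma is_Dy_inj (D D' : block_matrix R) : isDy D -> isDy D' -> D = D'.
Proof.
move=> hD hD'; apply: functional_extensionality_dep => i.
apply: functional_extensionality_dep => j; apply/matrixP => p q.
have [N [D0 dD]] := is_Dy_derive hD j.
have [N' [D0' dD']] := is_Dy_derive hD' j.
have [iN|Ni] := ltnP i (maxn N N'); last first.
  by rewrite D0 ?D0'// (leq_trans _ Ni)// ?leq_maxl ?leq_maxr.
pose e i p := block_col D q i p - block_col D' q i p.
suff : e i p = 0.
  rewrite /e /block_col -ltnS ltn_ord inord_val => /eqP.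
  by rewrite subr_eq0 => /eqP.
apply: (koornwinder_free (e := e) (N := maxn N N') ab gd rho0 size_RpolyS) => //.
- by case: (Ptilde_orthonormal gd (integrable_wPS d1 c1 iw)).
- by move=> m k mk; rewrite /e /block_col leqNgt mk subrr.
- move=> x y Om; have h := dD _ _ _ q (leq_maxl N N') Om.
  have h' := dD' _ _ _ q (leq_maxr N N') Om.
  case: h h' => _ h [_]; rewrite h => /eqP.
  rewrite -subr_eq0 -sumrB => /eqP sum0; rewrite -[RHS]sum0.
  apply: eq_bigr => m _; rewrite -sumrB; apply: eq_bigr => k _.
  by rewrite /e mulrBl.
- by rewrite (leq_trans (ltn_ord p)).
Qed.

Definition Dy_matrix : block_matrix R := fun i j => \matrix_(p, q)
  if (j == i.+1) && (q == p.+1 :> nat) then dP gamma delta p (d + 1) (c + 1)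
  else 0.

Lemma Dy_matrix_eq0 i j : j != i.+1 -> Dy_matrix i j = 0.
Proof. by move=> ij; apply/matrixP => p q; rewrite !mxE (negPf ij). Qed.

Lemma is_Dy_Dy_matrix : isDy Dy_matrix.
Proof.
move=> j; exists j; split=> [i ji|x y q Om].
  by rewrite Dy_matrix_eq0// ltn_eqF// ltnS.
under eq_fun do rewrite mxE.
case: j q => [|j] q.
  rewrite big_ord0 mxE ord1; exact: derive_koornwinder0.
rewrite big_ord_recr/= big1 ?add0r => [|i _]; last first.
  by rewrite Dy_matrix_eq0 ?mulmx0// eqSS gtn_eqF.
rewrite mxE; case: q => -[|k] kj /=.
  rewrite big1 => [|p _]; first exact: derive_koornwinder0.
  by rewrite !mxE andbF mulr0.
rewrite (bigD1 (Ordinal (kj : k < j.+1)%N))//= big1 ?addr0 => [|p pk]; last first.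
  rewrite !mxE eqxx /= eqSS; case: eqP => [kp|]; last by rewrite mulr0.
  by case/eqP: pk; apply: val_inj.
by rewrite !mxE !eqxx mulrC; exact: derive_koornwinderS.
Qed.

End Dy.

Theorem proposition5p3 (R : realType) (alpha beta gamma delta : R)
    (rho : R -> R) (a b c d : R)
    (halphabeta : alpha < beta) (hgammadelta : gamma < delta)
    (hrho : forall x, alpha < x < beta -> 0 < rho x)
    (hcase : case_i alpha beta rho \/ case_ii alpha beta gamma delta rho c d)
    (ha : -1 < a) (hb : -1 < b) (hc : -1 < c) (hd : -1 < d)
    (hint : weights_integrable alpha beta gamma delta rho a b c d) :
  (forall n k : nat, (k <= n)%N ->
     forall x y : R, alpha <= x <= beta ->
     is_derive y 1 (koornwinder alpha beta gamma delta rho a b c d n k x)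
       (if k is k'.+1 then
          dP gamma delta k' (d + 1) (c + 1) *
          koornwinder alpha beta gamma delta rho a b (c + 1) (d + 1)
            n.-1 k' x y
        else 0)) /\
  (exists! D : block_matrix R, is_Dy alpha beta gamma delta rho a b c d D) /\
  (forall D : block_matrix R, is_Dy alpha beta gamma delta rho a b c d D ->
     block_bandwidths D (-1) 1 /\ forall i j : nat, bandwidths (D i j) (-1) 1).
Proof.
have [_ iw _] := hint.
have uniqD := is_Dy_inj halphabeta hgammadelta hrho hc hd hint.
have isD : is_Dy alpha beta gamma delta rho a b c d (Dy_matrix gamma delta c d).
  exact: is_Dy_Dy_matrix.
split; [|split].
- move=> n [|k] kn x y _; first exact: derive_koornwinder0.
  exact: derive_koornwinderS.
- exists (Dy_matrix gamma delta c d); split => // D hD; exact: uniqD.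
- move=> D hD; rewrite (uniqD _ _ hD isD); split=> [i j|i j p q] pq.
    by apply: Dy_matrix_eq0; apply/eqP => ji; lia.
  by rewrite mxE; case: andP => // -[_ /eqP qp]; lia.
Qed.
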